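(* Let $H>0$ and $p,q\in(1,\infty)$, and let $p^*=p/(p-1)$. Then the positive solution of the boundary value problem \[(p-q)u'-pq(u')^2+(p+q)u\,u''+1=0,\qquad u(0)=u(H)=0,\] is \[u=\frac{2H}{q\,\pi_{p^*,q}}\cos_{p^*,q}^{p^*-1}\left(\frac{\pi_{p^*,q}}{2H}x\right)\sin_{p^*,q}\left(\frac{\pi_{p^*,q}}{2H}x\right).\]
   Context: Here $u=u(x)$ is a function of $x\in[0,H]$ and $'$ denotes $d/dx$. Generalized trigonometric functions: for $p,q\in(1,\infty)$, $\sin_{p,q}$ is the inverse function of $\sin_{p,q}^{-1}x:=\int_0^x \frac{dt}{(1-t^q)^{1/p}}$, $0\le x\le 1$, and $\pi_{p,q}:=2\sin_{p,q}^{-1}1=2\int_0^1\frac{dt}{(1-t^q)^{1/p}}$. Thus $\sin_{p,q}$ is increasing from $[0,\pi_{p,q}/2]$ onto $[0,1]$. One sets $\cos_{p,q}x:=(\sin_{p,q}x)'$, and $\cos_{p,q}^p x+\sin_{p,q}^q x=1$ for $x\in[0,\pi_{p,q}/2]$. In the claim these are used with the pair of parameters $(p^*,q)$. Powers are written $\cos_{p,q}^a x=(\cos_{p,q}x)^a$. *)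

(* Defs.v *)
From HB Require Import structures.
From mathcomp Require Import all_boot all_order all_algebra.
From mathcomp Require Import all_classical all_reals all_analysis.

Set Implicit Arguments.
Unset Strict Implicit.
Unset Printing Implicit Defensive.

Import Order.TTheory GRing.Theory Num.Theory.
Import numFieldNormedType.Exports.

Local Open Scope classical_set_scope.
Local Open Scope ring_scope.

(* The Lebesgue integral covers the improper case x = 1: the integrand takes
   the junk value 0 at the single point t = 1. *)
Definition gasin (R : realType) (p q : R) (x : R) : R :=
  \int[lebesgue_measure]_(t in `[0, x]) ((1 - t `^ q) `^ p^-1)^-1.

Definition gpi (R : realType) (p q : R) : R := 2 * gasin p q 1.

(* Meaningful on [0, gpi p q / 2], the image of [0, 1] under gasin p q. *)
Definition gsin (R : realType) (p q : R) : R -> R :=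
  pinv (`[0, 1] : set R) (gasin p q).

(* Derivative of f as a function defined on D only; it is the one-sided
   derivative at an end point of an interval D. *)
Definition derive_on (R : realType) (D : set R) (f : R -> R) (x : R) : R :=
  lim ((f y - f x) / (y - x) @[y --> within D x^']).

Definition gcos (R : realType) (p q : R) : R -> R :=
  derive_on `[0, gpi p q / 2] (gsin p q).

Definition conj_exp (R : realType) (p : R) : R := p / (p - 1).

(* Classical solutions, twice differentiable on ]0, H[ and continuous on
   [0, H]; values of u outside [0, H] are irrelevant. *)
Definition positive_solution (R : realType) (p q H : R) (u : R -> R) : Prop :=
  [/\ {within `[0, H], continuous u},
      {in `]0, H[, forall x : R, derivable u x 1 /\ derivable (derive1 u) x 1},
      u 0 = 0 /\ u H = 0,
      {in `]0, H[, forall x, 0 < u x} &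
      {in `]0, H[, forall x,
        (p - q) * derive1 u x - p * q * derive1 u x ^+ 2
          + (p + q) * u x * derive1n 2 u x + 1 = 0}].

(* Main.v *)
Require Import Defs.
From HB Require Import structures.
From mathcomp Require Import all_boot all_order all_algebra.
From mathcomp Require Import all_classical all_reals all_analysis.
From mathcomp Require Import measurable_realfun ring lra.

Set Implicit Arguments.
Unset Strict Implicit.
Unset Printing Implicit Defensive.

Import Order.TTheory GRing.Theory Num.Theory.
Import numFieldNormedType.Exports.

Local Open Scope classical_set_scope.
Local Open Scope ring_scope.

(** Let P = p / (p - 1), S = sin_{P,q} and W = (1 - S^q)^(1/p) S. Since
S' = (1 - S^q)^(1/P) and 1/p + 1/P = 1, one finds W' = 1 - (1 + q/p) S^q, and
x |-> W(cx) / (qc) with c = pi_{P,q} / (2H) is a positive solution.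

Conversely, for a positive solution u and v = u' the equation reads
(p + q) u v' = (p v + 1) (q v - 1). Both p v + 1 and 1 - q v therefore solve
linear homogeneous first-order equations; they are positive where v = 0, which
happens by Rolle's theorem, hence everywhere. So y = p (1 - q v) / (p + q) lies
in ]0, 1[, and u = k y^(1/q) (1 - y)^(1/p) for some constant k. Then
sin_{P,q}^{-1} (y^(1/q)) has derivative 1 / (qk), so that u(x) = k W(x/(qk) + D),
and the boundary conditions force D = 0 and H / (qk) = pi_{P,q} / 2. *)

(** * Continuity and derivatives of real functions *)

Section RealFunctions.
Variable R : realType.
Implicit Types (f g : R -> R) (a b x r : R).

(** At a point of [A] the subspace neighbourhoods are the traces on [A] of the ordinary ones. The
    epsilon-delta form treats interior points and end points of a segment alike. *)
Lemma within_continuousP (A : set R) f :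
  {within A, continuous f} <->
  forall x, A x -> forall e, 0 < e ->
    exists2 d, 0 < d & forall y, A y -> `|x - y| < d -> `|f x - f y| < e.
Proof.
rewrite continuous_subspace_in; split => [cf x Ax e e0|cf x /set_mem Ax].
  have := cf x (mem_set Ax); rewrite /continuous_at.
  move=> /cvgrPdist_lt /(_ _ e0) H0.
  have : within A (nbhs x) (fun y => `|f x - f y| < e).
    by rewrite (nbhs_subspace_in Ax); exact: H0.
  move=> /nbhs_ballP[d /= d0 H].
  by exists d => // y Ay xy; apply: H.
apply/cvgrPdist_lt => e e0.
suff : within A (nbhs x) (fun y => `|f x - f y| < e).
  by rewrite (nbhs_subspace_in Ax).
have [d d0 H] := cf x Ax e e0.
by apply/nbhs_ballP; exists d => // y xy Ay; exact: H.
Qed.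

Lemma within_continuous_compose (A B : set R) f g :
  (forall x, A x -> B (g x)) ->
  {within A, continuous g} -> {within B, continuous f} ->
  {within A, continuous (f \o g)}.
Proof.
move=> AB /within_continuousP cg /within_continuousP cf.
apply/within_continuousP => x Ax e e0.
have [d d0 fd] := cf _ (AB _ Ax) _ e0.
have [h h0 gh] := cg _ Ax _ d0.
by exists h => // y Ay xy; apply: fd; [exact: AB|exact: gh].
Qed.

(** A negative value would persist at all nearby points of the segment, and some of these are
    interior. *)
Lemma within_continuous_ge0 f a b : a < b -> {within `[a, b], continuous f} ->
  {in `]a, b[, forall x, 0 <= f x} -> {in `[a, b], forall x, 0 <= f x}.
Proof.
move=> ab /within_continuousP cf f0 x xab.
rewrite leNgt; apply/negP => fx0.
have [d d0 fd] := cf x xab (- f x) ltac:(by rewrite oppr_gt0).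
have [y yab xyd] : exists2 y, y \in `]a, b[ & `|x - y| < d.
  move: xab; rewrite in_itv/= => /andP[ax xb].
  (* A step m / 2 from x towards the farther end point stays inside []a, b[], since m / 2 < (b - a)
     / 2, and within d of x. *)
  have [m [m0 md mab]] : exists m, [/\ 0 < m, m < d & m < b - a].
    exists (Num.min (d / 2) ((b - a) / 2)).
    by split; rewrite /Num.min; case: ifPn => ?; lra.
  have [xm|mx] := ltP x ((a + b) / 2).
    exists (x + m / 2); first by rewrite in_itv/=; apply/andP; split; lra.
    by rewrite distrC addrC addKr gtr0_norm; lra.
  exists (x - m / 2); first by rewrite in_itv/=; apply/andP; split; lra.
  by rewrite subKr gtr0_norm; lra.
have := fd y (subset_itv_oo_cc yab) xyd.
have := f0 y yab; rewrite ltr_norml; lra.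
Qed.

(** Carries identities derived from the equation, which holds only inside the interval, to the end
    points, where the boundary conditions are. *)
Lemma within_continuous_eq f g a b : a < b ->
  {within `[a, b], continuous f} -> {within `[a, b], continuous g} ->
  {in `]a, b[, f =1 g} -> {in `[a, b], f =1 g}.
Proof.
move=> ab cf cg fg x xab.
have := @within_continuous_ge0 (f - g) a b ab.
have := @within_continuous_ge0 (g - f) a b ab.
move=> /(_ (within_continuousB cg cf)) H1 /(_ (within_continuousB cf cg)) H2.
apply/eqP; rewrite eq_le -subr_ge0 -(subr_ge0 (g x)); apply/andP; split.
  by apply: H1 => // y yab /=; rewrite !fctE fg// subrr.
by apply: H2 => // y yab /=; rewrite !fctE fg// subrr.
Qed.

(** The absolute value avoids negative bases, where [powR] takes a default value; this gives
    continuity on the whole line, 0 included. *)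
Lemma continuous_norm_powR r : 0 < r -> continuous (fun x => `|x| `^ r).
Proof.
move=> r0 x; have [->|x0] := eqVneq x 0.
  apply/cvgrPdist_lt => e e0; rewrite normr0 powR0 ?gt_eqF//.
  exists (e `^ r^-1) => /=; first exact: powR_gt0.
  move=> y /=; rewrite !sub0r !normrN (ger0_norm (powR_ge0 _ _)) => ye.
  rewrite (_ : e = (e `^ r^-1) `^ r).
    by apply: gt0_ltr_powR => //; rewrite nnegrE ?powR_ge0.
  by rewrite -powRrM mulVf ?gt_eqF// powRr1 ?ltW.
apply: (@continuous_comp _ _ _ (fun x => `|x|) (fun x => x `^ r)).
  exact: norm_continuous.
have nx : 0 < `|x| by rewrite normr_gt0.
apply: differentiable_continuous; apply/derivable1_diffP.
by have [] := @is_derive1_powR _ r _ nx.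
Qed.

Lemma within_continuousM (A : set R) f g :
  {within A, continuous f} -> {within A, continuous g} ->
  {within A, continuous (fun x => f x * g x)}.
Proof. by move=> cf cg x; exact: (cvgM (cf x) (cg x)). Qed.

Lemma within_continuous_cst (A : set R) (c : R) :
  {within A, continuous (fun=> c)}.
Proof. by apply: continuous_subspaceT; exact: cst_continuous. Qed.

Lemma within_continuous_powR (A : set R) f r : 0 < r ->
  (forall x, A x -> 0 <= f x) -> {within A, continuous f} ->
  {within A, continuous (fun x => f x `^ r)}.
Proof.
move=> r0 f0 cf.
apply: (@subspace_eq_continuous _ _ _ ((fun x => `|x| `^ r) \o f)).
  by move=> x /set_mem Ax /=; rewrite ger0_norm// f0.
by apply: within_continuous_comp => // x _; exact: continuous_norm_powR.
Qed.

Lemma is_derive_mull (c x : R) : is_derive x 1 (fun t => c * t) c.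
Proof.
by have := is_deriveZ c (is_derive_id x 1); rewrite /GRing.scale/= mulr1.
Qed.

Lemma is_derive_cstB f (c x l : R) : is_derive x 1 f l ->
  is_derive x 1 (fun t => c - f t) (- l).
Proof.
move=> dfx; have h := is_deriveB (is_derive_cst c x 1) dfx.
by rewrite sub0r in h.
Qed.

Lemma is_derive_powR_comp f (r x l : R) : 0 < f x -> is_derive x 1 f l ->
  is_derive x 1 (fun t => f t `^ r) (r * f x `^ (r - 1) * l).
Proof.
move=> fx0 dfx.
exact: (@is_derive1_comp _ (fun y => y `^ r) f x _ _ (is_derive1_powR _ fx0) dfx).
Qed.

Lemma is_derive_continuous f (x l : R) : is_derive x 1 f l ->
  {for x, continuous f}.
Proof. by case=> /derivable1_diffP/differentiable_continuous. Qed.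

Lemma derive0_oo_cst f a b :
  {in `]a, b[, forall x, is_derive x 1 f 0} ->
  {in `]a, b[ &, forall x y, f x = f y}.
Proof.
move=> df x y.
wlog xy : x y / x <= y.
  move=> H xab yab; have [|/ltW] := leP x y => h; first exact: H.
  by apply/esym/H.
move=> xab yab.
have sub z : z \in `[x, y] -> z \in `]a, b[.
  move: xab yab; rewrite !in_itv/= => /andP[? ?] /andP[? ?] /andP[? ?].
  by apply/andP; split; lra.
have [||c _] := @MVT_segment _ f (fun=> 0) x y xy.
- by move=> z /subset_itv_oo_cc zxy; apply/df/sub.
- apply: derivable_within_continuous => z zxy.
  by have [] := df z (sub z zxy).
by rewrite mul0r => /eqP; rewrite subr_eq0 => /eqP ->.
Qed.

End RealFunctions.

(** * The function arcsin_{p,q} *)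

Section GeneralizedSine.
Variables (R : realType) (p q : R).
Hypotheses (hp : 1 < p) (hq : 1 < q).

Local Notation mu := (@lebesgue_measure R).
Local Notation df := (fun t : R => ((1 - t `^ q) `^ p^-1)^-1).

Let p0 : 0 < p. Proof. exact: lt_trans hp. Qed.
Let q0 : 0 < q. Proof. exact: lt_trans hq. Qed.
Let pV0 : 0 < p^-1. Proof. by rewrite invr_gt0. Qed.
Let pV1 : p^-1 < 1. Proof. by rewrite invf_lt1. Qed.

(** The bound t^q <= t yields 1 - t <= 1 - t^q, the comparison behind the integrability of the
    integrand. *)
Lemma powR_itv01 (t : R) : 0 <= t <= 1 -> 0 <= t `^ q <= t.
Proof.
move=> /andP[t0 t1]; rewrite powR_ge0/=.
have [->|tN0] := eqVneq t 0; first by rewrite powR0// gt_eqF.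
by apply: ge1r_powR; [rewrite lt_neqAle eq_sym tN0 t0|exact: ltW].
Qed.

Lemma powR_itv_oo01 (t : R) : 0 < t < 1 -> 0 < t `^ q < 1.
Proof.
move=> /andP[t0 t1]; rewrite powR_gt0//=.
have /powR_itv01/andP[_ h] : 0 <= t <= 1 by rewrite !ltW.
exact: le_lt_trans t1.
Qed.

Lemma gasin_integrand_ge0 (t : R) : 0 <= df t.
Proof. by rewrite invr_ge0 powR_ge0. Qed.

Lemma measurable_gasin_integrand (A : set R) : measurable A ->
  measurable_fun A df.
Proof.
move=> mA; apply: (@measurable_funS _ _ _ _ setT) => //.
rewrite [X in measurable_fun _ X](_ : _ =
  (fun x : R => x `^ (- p^-1)) \o (fun t => 1 - t `^ q)).
  apply: measurableT_comp; first exact: measurable_powR.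
  by apply: measurable_funB => //; exact: measurable_powR.
by apply/funext => t /=; rewrite powRN.
Qed.

(* On [0, 1[ the integrand is at most (1 - t)^(-1/p), which has the primitive
   - (1 - t)^(1 - 1/p) / (1 - 1/p). *)
Lemma integral_gasin_integrand_le (b : R) : 0 < b < 1 ->
  (\int[mu]_(t in `[0%R, b]) (df t)%:E <= ((1 - p^-1)^-1)%:E)%E.
Proof.
move=> /andP[b0 b1]; have c0 : 0 < 1 - p^-1 by rewrite subr_gt0.
pose g (t : R) := (1 - t) `^ (- p^-1).
pose G (t : R) := - ((1 - p^-1)^-1 * (1 - t) `^ (1 - p^-1)).
have dG (t : R) : t < 1 -> is_derive t 1 G (g t).
  move=> t1.
  have h := @is_derive_powR_comp R (fun t => 1 - t) (1 - p^-1) t (- 1)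
    ltac:(move=> /=; lra) (is_derive_cstB 1 (is_derive_id t 1)).
  have {}h := is_deriveN (is_deriveZ (1 - p^-1)^-1 h).
  apply: is_derive_eq h _.
  rewrite /g; have -> : 1 - p^-1 - 1 = - p^-1 by lra.
  rewrite /GRing.scale/=; field.
  by rewrite subr_eq0 !gt_eqF.
have cg : {within `[0, b], continuous g}.
  apply: derivable_within_continuous => t; rewrite in_itv/= => /andP[_ tb].
  by have [] := @is_derive_powR_comp R (fun t => 1 - t) (- p^-1) t (- 1)
    ltac:(move=> /=; lra) (is_derive_cstB 1 (is_derive_id t 1)).
have cG t : t < 1 -> {for t, continuous G}.
  by move=> /dG; exact: is_derive_continuous.
have FTC : (\int[mu]_(t in `[0%R, b]) (g t)%:E = (G b)%:E - (G 0)%:E)%E.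
  apply: continuous_FTC2 => //.
    split.
    - by move=> t; rewrite in_itv/= => /andP[_ tb]; have [] := dG t (lt_trans tb b1).
    - by apply: cvg_at_right_filter; apply: cG.
    - by apply: cvg_at_left_filter; apply: cG.
  move=> t; rewrite in_itv/= => /andP[_ tb].
  by rewrite derive1E; have [_ ->] := dG t (lt_trans tb b1).
apply: (@le_trans _ _ (\int[mu]_(t in `[0%R, b]) (g t)%:E)%E).
  apply: ge0_le_integral => //=.
  - by move=> t _; rewrite lee_fin gasin_integrand_ge0.
  - by apply/measurable_EFinP; apply: measurable_gasin_integrand.
  - apply/measurable_EFinP; exact: subspace_continuous_measurable_fun.
  - move=> t; rewrite /= in_itv/= => /andP[t0 tb].
    have t01 : 0 <= t <= 1 by rewrite t0 ltW// (le_lt_trans tb).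
    have /andP[tq0 tqt] := powR_itv01 t01.
    rewrite lee_fin /g powRN lef_pV2 ?posrE ?powR_gt0; try lra.
    by apply: ge0_ler_powR; rewrite ?nnegrE; try lra; exact: ltW.
rewrite FTC -EFinB lee_fin /G subr0 powR1 mulr1 opprK.
by rewrite addrC lerBlDr lerDl mulr_ge0// ?powR_ge0// invr_ge0 ltW.
Qed.

(** Monotone convergence along segments increasing to [[0, 1[], on which the integrals have a common
    bound. *)
Lemma integrable_gasin_integrand : mu.-integrable `[0, 1] (EFin \o df).
Proof.
apply/integrableP; split; first by apply/measurable_EFinP; apply: measurable_gasin_integrand.
under eq_integral do rewrite /= ger0_norm ?gasin_integrand_ge0//.
(* The null point 1 is dropped, since the sets [F n] below exhaust only [[0, 1[]. *)
rewrite -integral_itv_bndo_bndc; last by apply/measurable_EFinP; apply: measurable_gasin_integrand.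
(* The offset n + 2 puts the right end strictly between 0 and 1 already for n = 0. *)
pose F (n : nat) : set R := `[0, 1 - n.+2%:R^-1]%classic.
have bn (n : nat) : 0 < (1 : R) - n.+2%:R^-1 < 1.
  have n0 : 0 < n.+2%:R :> R by rewrite ltr0n.
  by rewrite subr_gt0 gtrBl invr_gt0 n0 andbT invf_lt1// ltr1n.
have -> : `[0, 1[%classic = \bigcup_n F n.
  apply/seteqP; split => [t /=|t [n _]].
    rewrite in_itv/= => /andP[t0 t1].
    have t10 : 0 < 1 - t by rewrite subr_gt0.
    (* For this n one has (1 - t)^-1 < n + 1, hence 1 / (n + 2) <= 1 - t. *)
    exists (Num.truncn (1 - t)^-1) => //; rewrite /F/= in_itv/= t0/=.
    rewrite lerBrDl -lerBrDr -[leRHS]invrK lef_pV2 ?posrE ?invr_gt0 ?ltr0n//.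
    apply/ltW; apply: (lt_le_trans (truncnS_gt _)).
    by rewrite ler_nat.
  rewrite /F/= !in_itv/= => /andP[-> h]; apply: le_lt_trans h _.
  by have /andP[] := bn n.
have cvF : (\int[mu]_(t in F n) (df t)%:E @[n --> \oo]
    --> \int[mu]_(t in \bigcup_n F n) (df t)%:E)%E.
  apply: ge0_nondecreasing_set_cvg_integral.
  - move=> n m nm; apply/subsetPset => t; rewrite /F/= !in_itv/= => /andP[-> h].
    apply: (le_trans h); rewrite lerD2l lerN2 lef_pV2 ?posrE ?ltr0n//.
    by rewrite ler_nat !ltnS.
  - by move=> n; exact: measurable_itv.
  - by move=> n; apply/measurable_EFinP; apply: measurable_gasin_integrand; exact: measurable_itv.
  - by move=> n t _; rewrite lee_fin gasin_integrand_ge0.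
rewrite -(cvg_lim _ cvF)//; apply: (@le_lt_trans _ _ ((1 - p^-1)^-1)%:E);
  last by rewrite ltry.
apply: lime_le; first by apply/cvg_ex; eexists; exact: cvF.
by apply: nearW => n; exact: integral_gasin_integrand_le.
Qed.

Lemma gasin0 : gasin p q 0 = 0.
Proof. by rewrite /gasin set_itv1 Rintegral_set1. Qed.

(** Integrability up to 1 gives continuity there too, although the integrand blows up. *)
Lemma gasin_continuous : {within `[0, 1], continuous (gasin p q)}.
Proof.
exact: (parameterized_integral_continuous ler01 integrable_gasin_integrand).
Qed.

Lemma is_derive_gasin (x : R) : 0 < x < 1 -> is_derive x 1 (gasin p q) (df x).
Proof.
move=> /andP[x0 x1].
have [|] := @continuous_FTC1_closed _ df 0 x 1 x1 integrable_gasin_integrand x0.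
  have /andP[h1 h2] : 0 < x `^ q < 1 by apply: powR_itv_oo01; rewrite x0 x1.
  apply: differentiable_continuous; apply/derivable1_diffP/derivableV.
    by rewrite gt_eqF// powR_gt0; lra.
  by have [] := @is_derive_powR_comp R (fun t => 1 - t `^ q) p^-1 x _
    ltac:(move=> /=; lra) (is_derive_cstB 1 (is_derive1_powR q x0)).
by move=> dg dgE; split => //; rewrite -derive1E.
Qed.

Lemma gasin_lt (x y : R) : 0 <= x -> x < y -> y <= 1 -> gasin p q x < gasin p q y.
Proof.
move=> x0 xy y1.
have d (z : R) : z \in `]0, 1[%R -> is_derive z 1 (gasin p q) (df z).
  by rewrite in_itv/=; exact: is_derive_gasin.
apply: (@gtr0_derive1_incr _ (gasin p q) 0 1) => //.
- by move=> z z01; have [] := d z z01.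
- move=> z z01; rewrite derive1E; have [_ ->] := d z z01.
  move: z01; rewrite in_itv/= => /powR_itv_oo01 /andP[? ?].
  by rewrite invr_gt0 powR_gt0//; lra.
- exact: gasin_continuous.
Qed.

End GeneralizedSine.

(** * The functions sin_{p,q} and cos_{p,q} *)

Section GeneralizedSineInverse.
Variables (R : realType) (p q : R).
Hypotheses (hp : 1 < p) (hq : 1 < q).

Local Notation T := (gpi p q / 2).
Local Notation S := (gsin p q).

Let p0 : 0 < p. Proof. exact: lt_trans hp. Qed.
Let q0 : 0 < q. Proof. exact: lt_trans hq. Qed.

Lemma gpi_half : T = gasin p q 1.
Proof. by rewrite /gpi mulrC mulKf. Qed.

Lemma gpi_half_gt0 : 0 < T.
Proof. by rewrite gpi_half -(gasin0 p q); exact: gasin_lt. Qed.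

Lemma gasin_inj : {in `[0, 1] &, injective (gasin p q)}.
Proof.
move=> x y; rewrite !in_itv/= => /andP[x0 x1] /andP[y0 y1] xy.
case: (ltgtP x y) => // h.
  by have := gasin_lt hp hq x0 h y1; rewrite xy ltxx.
by have := gasin_lt hp hq y0 h x1; rewrite xy ltxx.
Qed.

(** Injectivity on [[0, 1]] makes the partial inverse [pinv] a genuine left inverse there. *)
Lemma gasinK : {in `[0, 1], cancel (gasin p q) S}.
Proof.
move=> x x01; rewrite /gsin; apply: pinvKV; last exact/mem_set.
by move=> a b /set_mem ? /set_mem ?; exact: gasin_inj.
Qed.

Lemma gasin_onto (t : R) : 0 <= t <= T ->
  exists2 x, 0 <= x <= 1 & gasin p q x = t.
Proof.
move=> t0T; have [||x] := @IVT _ (gasin p q) 0 1 t ler01.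
- exact: gasin_continuous.
- have := gpi_half_gt0; rewrite gasin0 -gpi_half => /ltW T0.
  by rewrite (min_idPl T0) (max_idPr T0).
by rewrite in_itv/= => x01 <-; exists x.
Qed.

Lemma gsin_itv (t : R) : 0 <= t <= T -> 0 <= S t <= 1.
Proof. by move=> /gasin_onto[x x01 <-]; rewrite gasinK. Qed.

Lemma gsinK (t : R) : 0 <= t <= T -> gasin p q (S t) = t.
Proof. by move=> /gasin_onto[x x01 <-]; rewrite gasinK. Qed.

Lemma gsin0 : S 0 = 0.
Proof. by rewrite -{1}(gasin0 p q) gasinK// in_itv/= lexx ler01. Qed.

Lemma gsinT : S T = 1.
Proof. by rewrite gpi_half gasinK// in_itv/= lexx ler01. Qed.

Lemma gsin_itv_oo (t : R) : 0 < t < T -> 0 < S t < 1.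
Proof.
move=> /andP[t0 tT]; have t0T : 0 <= t <= T by rewrite !ltW.
have /andP[S0 S1] := gsin_itv t0T; have SK := gsinK t0T.
rewrite !lt_neqAle S0 S1 !andbT; apply/andP; split; apply/eqP => SE.
  by move: t0; rewrite -SK -SE gasin0 ltxx.
by move: tT; rewrite -SK SE gpi_half ltxx.
Qed.

Lemma gsin_continuous : {within `[0, T], continuous S}.
Proof.
have := @segment_can_le_continuous _ 0 1 (gasin p q) S ler01
  (gasin_continuous hp hq) gasinK.
by rewrite gasin0 -gpi_half.
Qed.

(** The inverse function rule: the derivative is the reciprocal of the integrand at [S t]. *)
Lemma is_derive_gsin (t : R) : 0 < t < T ->
  is_derive t 1 S ((1 - S t `^ q) `^ p^-1).
Proof.
move=> t0T; have /andP[t0 tT] := t0T.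
have SK : gasin p q (S t) = t by apply: gsinK; rewrite !ltW.
have S01 := gsin_itv_oo t0T.
have near01 : \forall x \near S t, x \in `]0, 1[.
  by apply: near_in_itvoo; rewrite in_itv.
(* The rule applies at a point of the form [gasin p q (S t)] and produces a reciprocal, so both are
   exhibited. *)
rewrite -{1}SK -[X in is_derive _ _ _ X]invrK.
apply: is_derive_inverse.
- by near=> x; apply: gasinK; apply: subset_itv_oo_cc; near: x.
- near=> x; have x01 : x \in `]0, 1[ by near: x.
  rewrite in_itv/= in x01.
  exact: is_derive_continuous (is_derive_gasin hp hq x01).
- exact: is_derive_gasin.
- have /andP[? ?] := powR_itv_oo01 hq S01.
  by rewrite invr_neq0// gt_eqF// powR_gt0//; lra.
Unshelve. all: by end_near. Qed.

Lemma gsin_powR_itv (t : R) : 0 <= t <= T -> 0 <= S t `^ q <= 1.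
Proof.
move=> /gsin_itv S01; have /andP[-> h] := powR_itv01 hq S01.
by apply: (le_trans h); case/andP: S01.
Qed.

Lemma gsin_powR_itv_oo (t : R) : 0 < t < T -> 0 < S t `^ q < 1.
Proof. by move=> /gsin_itv_oo/(powR_itv_oo01 hq). Qed.

Lemma within_continuous_1B_gsin_powR (r : R) : 0 < r ->
  {within `[0, T], continuous (fun t => (1 - S t `^ q) `^ r)}.
Proof.
move=> r0; apply: within_continuous_powR => //.
  by move=> t /=; rewrite in_itv/= => /gsin_powR_itv/andP[_]; rewrite subr_ge0.
have cSq : {within `[0, T], continuous (fun t => S t `^ q)}.
  apply: within_continuous_powR => //; last exact: gsin_continuous.
  by move=> t /=; rewrite in_itv/= => /gsin_itv/andP[].
have c1 : {within `[0, T], continuous (cst 1 : R -> R)}.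
  exact: within_continuous_cst.
exact: (within_continuousB c1 cSq).
Qed.

(* By the mean value theorem every difference quotient of gsin is a value of
   the continuous function (1 - gsin^q)^(1/p) nearby; this also covers the
   one-sided derivatives at the end points. *)
Lemma gcosE (t : R) : 0 <= t <= T -> gcos p q t = (1 - S t `^ q) `^ p^-1.
Proof.
move=> t0T; have T0 := gpi_half_gt0.
have pV0 : 0 < p^-1 by rewrite invr_gt0.
have /within_continuousP cC := within_continuous_1B_gsin_powR pV0.
(* A limit is determined only along a proper filter, so t must be an accumulation point of [[0, T]],
   end points included. *)
have PF : ProperFilter (within (`[0, T]%classic : set R) t^').
  apply: Build_ProperFilter_ex => A.
  rewrite /within/= => -[d/= d0 dA].
  have /andP[t0 tT] := t0T.
  (* The witness lies at distance m from t, away from the nearer end point; m <= T / 2 keeps it in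
     [[0, T]]. *)
  pose m := Num.min (d / 2) (T / 2).
  have m0 : 0 < m by rewrite /m /Num.min; case: ifPn => _; lra.
  have md : m < d by rewrite /m /Num.min; case: ifPn => ?; lra.
  have mT : m <= T / 2 by rewrite /m /Num.min; case: ifPn => ?; lra.
  have [th|th] := leP t (T / 2).
    exists (t + m); apply: dA => //=.
    - by rewrite distrC addrC addKr gtr0_norm.
    - by rewrite gt_eqF// ltrDl.
    - by rewrite in_itv/=; apply/andP; split; lra.
  exists (t - m); apply: dA => //=.
  - by rewrite subKr gtr0_norm.
  - by rewrite lt_eqF// gtrBl.
  - by rewrite in_itv/=; apply/andP; split; lra.
apply: cvg_lim => //.
apply/cvgrPdist_lt => e e0.
have [d d0 H] := cC t t0T e e0.
near=> y.
have yT : y \in `[0, T].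
  near: y; rewrite near_withinE; exact: nearW.
have yt : y != t by near: y; apply: cvg_within; exact: withinT.
have tyd : `|t - y| < d.
  near: y; apply: cvg_within; apply: cvg_within; exact: nbhsx_ballx.
have [c [c0T tcd ->]] : exists c, [/\ c \in `[0, T], `|t - c| < d &
    (S y - S t) / (y - t) = (1 - S c `^ q) `^ p^-1].
  have MVT' a b : a < b -> a \in `[0, T] -> b \in `[0, T] ->
      exists2 c, a < c < b & S b - S a = (1 - S c `^ q) `^ p^-1 * (b - a).
    move=> ab /[!in_itv]/= /andP[a0 aT] /andP[b0 bT].
    have [||c] := @MVT _ S (fun c => (1 - S c `^ q) `^ p^-1) a b ab.
    - move=> z; rewrite in_itv/= => /andP[az zb]; apply: is_derive_gsin.
      by rewrite (le_lt_trans a0 az) (lt_le_trans zb bT).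
    - apply: continuous_subspaceW gsin_continuous => z /=.
      rewrite !in_itv/= => /andP[az zb].
      by rewrite (le_trans a0 az) (le_trans zb bT).
    by rewrite in_itv/= => cab E; exists c.
  have [yt'|ty] := ltP y t.
    have [//|//|c /andP[yc ct] E] := MVT' y t yt'; exists c; split.
    - move: yT t0T; rewrite !in_itv/= => /andP[? ?] /andP[? ?].
      by apply/andP; split; lra.
    - by move: tyd; rewrite !gtr0_norm ?subr_gt0//; lra.
    - by rewrite -opprB E -mulrN opprB mulfK// subr_eq0.
  have {}ty : t < y by rewrite lt_neqAle eq_sym yt.
  have [//|//|c /andP[tc cy] E] := MVT' t y ty; exists c; split.
  - move: yT t0T; rewrite !in_itv/= => /andP[? ?] /andP[? ?].
    by apply/andP; split; lra.
  - by move: tyd; rewrite !ltr0_norm ?subr_lt0//; lra.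
  - by rewrite E mulfK// subr_eq0.
exact: H.
Unshelve. all: by end_near. Qed.

End GeneralizedSineInverse.

(** * Existence *)

Section Profile.
Variables (R : realType) (p q : R).
Hypotheses (hp : 1 < p) (hq : 1 < q).

Local Notation P := (conj_exp p).
Local Notation T := (gpi P q / 2).
Local Notation S := (gsin P q).

Let p0 : 0 < p. Proof. exact: lt_trans hp. Qed.
Let q0 : 0 < q. Proof. exact: lt_trans hq. Qed.
Let pB1 : p - 1 != 0. Proof. by rewrite subr_eq0 gt_eqF. Qed.

Lemma conj_exp_gt1 : 1 < P.
Proof. by rewrite /conj_exp ltr_pdivlMr ?subr_gt0//; lra. Qed.
Let hP := conj_exp_gt1.

Lemma conj_expV : P^-1 = 1 - p^-1.
Proof. by rewrite /conj_exp; field; rewrite pB1 gt_eqF. Qed.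

(** This exponent turns cos^(P - 1) into (1 - S^q)^(1/p). *)
Lemma conj_expVM : P^-1 * (P - 1) = p^-1.
Proof. by rewrite /conj_exp; field; rewrite pB1 gt_eqF. Qed.

(** The function W of the overview, with the power of the cosine already in closed form, so that the
    power rule applies inside the interval. *)
Definition profile (t : R) := (1 - S t `^ q) `^ p^-1 * S t.

Lemma profileE (t : R) : 0 <= t <= T ->
  gcos P q t `^ (P - 1) * S t = profile t.
Proof. by move=> t0T; rewrite gcosE// -powRrM conj_expVM. Qed.

Lemma profile_continuous : {within `[0, T], continuous profile}.
Proof.
have c1 := @within_continuous_1B_gsin_powR _ _ _ hP hq p^-1 ltac:(by rewrite invr_gt0).
exact: within_continuousM c1 (gsin_continuous hP hq).
Qed.

Lemma is_derive_gsin_powR (t : R) : 0 < t < T ->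
  is_derive t 1 (fun t => S t `^ q)
    (q * S t `^ (q - 1) * (1 - S t `^ q) `^ P^-1).
Proof.
move=> t0T; have /andP[S0 S1] := gsin_itv_oo hP hq t0T.
exact: is_derive_powR_comp (is_derive_gsin hP hq t0T).
Qed.

(** In the product rule the factor (1 - S^q)^(1/p) S' equals 1 - S^q because 1/p + 1/P = 1; in the
    other term the powers of 1 - S^q cancel and - (q/p) S^q remains. *)
Lemma is_derive_profile (t : R) : 0 < t < T ->
  is_derive t 1 profile (1 - (1 + q / p) * S t `^ q).
Proof.
move=> t0T; have /andP[S0 S1] := gsin_itv_oo hP hq t0T.
have /andP[y0 y1] := gsin_powR_itv_oo hP hq t0T.
have dS := is_derive_gsin hP hq t0T.
have y10 : 0 < 1 - S t `^ q by rewrite subr_gt0.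
have dw := @is_derive_powR_comp _ (fun t => 1 - S t `^ q) p^-1 t _ y10
  (is_derive_cstB 1 (is_derive_gsin_powR t0T)).
have dW := is_deriveM dw dS.
apply: is_derive_eq dW _; rewrite /GRing.scale/=.
have -> : p^-1 - 1 = - P^-1 by rewrite conj_expV; lra.
rewrite powRN; set C := _ `^ P^-1; have C0 : C != 0 by rewrite gt_eqF// powR_gt0.
have wC : (1 - S t `^ q) `^ p^-1 * C = 1 - S t `^ q.
  rewrite /C -powRD; last by rewrite (gt_eqF y10) implybT.
  by rewrite conj_expV [p^-1 + _]addrC subrK powRr1// ltW.
rewrite wC.
have <- : S t * S t `^ (q - 1) = S t `^ q by rewrite mulr_powRB1// ltW.
by field; rewrite C0 gt_eqF.
Qed.

Lemma is_derive2_profile (t : R) : 0 < t < T ->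
  is_derive t 1 (fun t => 1 - (1 + q / p) * S t `^ q)
    (- ((1 + q / p) * (q * S t `^ (q - 1) * (1 - S t `^ q) `^ P^-1))).
Proof.
by move=> /is_derive_gsin_powR d; exact: is_derive_cstB (is_deriveZ (1 + q / p) d).
Qed.

Lemma profile_gt0 (t : R) : 0 < t < T -> 0 < profile t.
Proof.
move=> t0T; have /andP[S0 S1] := gsin_itv_oo hP hq t0T.
have /andP[y0 y1] := gsin_powR_itv_oo hP hq t0T.
by rewrite mulr_gt0// powR_gt0// subr_gt0.
Qed.

Lemma profile0 : profile 0 = 0.
Proof. by rewrite /profile gsin0// mulr0. Qed.

Lemma profileT : profile T = 0.
Proof.
by rewrite /profile gsinT// powR1 subrr powR0 ?mul0r// gt_eqF// invr_gt0.
Qed.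

(** Positivity inside leaves only the end points; this later fixes the shift and the scale of a
    solution from its boundary values. *)
Lemma profile_eq0 (t : R) : 0 <= t <= T -> profile t = 0 -> t = 0 \/ t = T.
Proof.
move=> /andP[]; rewrite !le_eqVlt => /predU1P[->|t0]; first by left.
move=> /predU1P[->|tT]; first by right.
by move=> Pt; have := @profile_gt0 t; rewrite t0 tT Pt ltxx => /(_ isT).
Qed.

(** The second factor is the derivative of S^q. Hence W W'' is a polynomial in y = S^q, and the
    differential equation reduces to a polynomial identity in y. *)
Lemma profile_ode (t : R) : 0 < t < T ->
  profile t * (q * S t `^ (q - 1) * (1 - S t `^ q) `^ P^-1) =
  q * (S t `^ q * (1 - S t `^ q)).
Proof.
move=> t0T; have /andP[S0 S1] := gsin_itv_oo hP hq t0T.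
have /andP[y0 y1] := gsin_powR_itv_oo hP hq t0T.
have y10 : 0 < 1 - S t `^ q by rewrite subr_gt0.
have wC : (1 - S t `^ q) `^ p^-1 * (1 - S t `^ q) `^ P^-1 = 1 - S t `^ q.
  rewrite -powRD; last by rewrite (gt_eqF y10) implybT.
  by rewrite conj_expV [p^-1 + _]addrC subrK powRr1// ltW.
rewrite -{2}wC /profile.
have -> : S t `^ q = S t * S t `^ (q - 1) by rewrite mulr_powRB1// ltW.
by ring.
Qed.

Variable H : R.
Hypothesis hH : 0 < H.

Local Notation c := (gpi P q / (2 * H)).

Let T0 : 0 < T. Proof. exact: gpi_half_gt0. Qed.

Lemma formula_scaleE : c = T / H.
Proof. by rewrite invfM mulrA. Qed.

Let c0 : 0 < c. Proof. by rewrite formula_scaleE divr_gt0. Qed.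

Lemma formula_amplitudeE : 2 * H / (q * gpi P q) = (q * c)^-1.
Proof.
by rewrite -[RHS]invrK !invfM !invrK; rewrite mulrC [in RHS]mulrA -mulrA; congr (_ * _); rewrite mulrC.
Qed.

Lemma formula_profileE (x : R) : 0 <= x <= H ->
  2 * H / (q * gpi P q) * gcos P q (c * x) `^ (P - 1) * S (c * x) =
  (q * c)^-1 * profile (c * x).
Proof.
move=> /andP[x0 xH]; rewrite formula_amplitudeE -mulrA profileE//; apply/andP; split.
  by apply: mulr_ge0 => //; exact: ltW.
by rewrite formula_scaleE mulrAC ler_pdivrMr// ler_pM2l.
Qed.

Lemma profile_solution (u : R -> R) :
  (forall x, 0 <= x <= H -> u x = (q * c)^-1 * profile (c * x)) ->
  positive_solution p q H u.
Proof.
move=> uE.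
pose y (x : R) := S (c * x) `^ q.
have cHT : c * H = T by rewrite formula_scaleE divfK// gt_eqF.
have cx_oo (x : R) : x \in `]0, H[ -> 0 < c * x < T.
  by rewrite in_itv/= => /andP[x0 xH]; rewrite -cHT mulr_gt0// ltr_pM2l.
have cx_cc (x : R) : x \in `[0, H] -> 0 <= c * x <= T.
  rewrite in_itv/= => /andP[x0 xH]; rewrite -cHT ler_pM2l// xH andbT.
  by rewrite mulr_ge0// ltW.
have near_oo (x : R) : x \in `]0, H[ -> \forall z \near x, z \in `]0, H[.
  exact: near_in_itvoo.
have c_neq0 : c != 0 by rewrite gt_eqF.
have q_neq0 : q != 0 by rewrite gt_eqF.
have du (x : R) : x \in `]0, H[ ->
    is_derive x 1 u (q^-1 * (1 - (1 + q / p) * y x)).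
  move=> x0H; have dP := is_derive_profile (cx_oo x x0H).
  have d := is_deriveZ (q * c)^-1
    (@is_derive1_comp _ profile (fun x => c * x) x _ _ dP (is_derive_mull c x)).
  (* The formula for u is assumed on [[0, H]] only, which is a neighbourhood of each interior x. *)
  have {}d := @near_eq_is_derive _ _ _ _ u x 1 _ _ d.
  apply: is_derive_eq (d _) _.
    near=> z; have : z \in `]0, H[ by near: z; exact: near_oo.
    move=> /subset_itv_oo_cc; rewrite /= in_itv/= => z0H.
    by rewrite uE.
  rewrite /GRing.scale/= /y; move: (c) c_neq0 => k kN.
  by field; rewrite kN q_neq0 gt_eqF.
have du1 (x : R) : x \in `]0, H[ ->
    derive1 u x = q^-1 * (1 - (1 + q / p) * y x).
  by move=> x0H; rewrite derive1E; have [_ ->] := du x x0H.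
have ddu (x : R) : x \in `]0, H[ -> is_derive x 1 (derive1 u)
    (- (q^-1 * c * ((1 + q / p) * (q * S (c * x) `^ (q - 1) *
       (1 - y x) `^ P^-1)))).
  move=> x0H; have dP := is_derive2_profile (cx_oo x x0H).
  have d := is_deriveZ q^-1
    (@is_derive1_comp _ _ (fun x => c * x) x _ _ dP (is_derive_mull c x)).
  have {}d := @near_eq_is_derive _ _ _ _ (derive1 u) x 1 _ _ d.
  apply: is_derive_eq (d _) _.
    near=> z; have : z \in `]0, H[ by near: z; exact: near_oo.
    by move=> /du1 ->.
  by rewrite /GRing.scale/= /y; ring.
split.
- have cl : {within `[0, H], continuous (fun x => c * x)}.
    apply: derivable_within_continuous => x _.
    by have [] := is_derive_mull c x.
  have cP : {within `[0, H], continuous (profile \o (fun x => c * x))}.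
    by apply: (within_continuous_compose _ cl profile_continuous) => x /cx_cc.
  apply: (subspace_eq_continuous _
    (within_continuousM (@within_continuous_cst _ _ (q * c)^-1) cP)).
  by move=> x /set_mem/=; rewrite in_itv/= => /uE.
- by move=> x x0H; split; [have [] := du x x0H|have [] := ddu x x0H].
- by rewrite !uE ?lexx ?ltW// mulr0 profile0 cHT profileT mulr0.
- move=> x x0H; rewrite uE; last by have := subset_itv_oo_cc x0H; rewrite /= in_itv.
  by rewrite mulr_gt0 ?profile_gt0 ?cx_oo// invr_gt0 mulr_gt0.
- move=> x x0H; rewrite du1// [derive1n 2 u x]derive1E.
  have [_ ->] := ddu x x0H.
  rewrite uE; last by have := subset_itv_oo_cc x0H; rewrite /= in_itv.
  have := profile_ode (cx_oo x x0H); rewrite -/(y x).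
  set D := (X in profile _ * X) => E.
  (* The scale c cancels between u and u'', leaving the product W W'' that [E] evaluates. *)
  have -> : (p + q) * ((q * c)^-1 * profile (c * x)) *
      - (q^-1 * c * ((1 + q / p) * D)) =
    - ((p + q) * (1 + q / p) * q^-1 ^+ 2 * (profile (c * x) * D)).
    move: (c) c_neq0 D E => k kN D _.
    by field; rewrite kN q_neq0 gt_eqF.
  by rewrite E; field; rewrite q_neq0 gt_eqF.
Unshelve. all: by end_near. Qed.

End Profile.

(** * Uniqueness *)

Section LinearODE.
Variables (R : realType) (a b : R) (z h : R -> R).
Hypothesis dz : {in `]a, b[, forall x : R, is_derive x 1 z (h x * z x)}.
Hypothesis ch : {in `]a, b[, continuous h}.

Let sub (x y t : R) : x \in `]a, b[ -> y \in `]a, b[ -> t \in `[x, y] ->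
  t \in `]a, b[.
Proof.
rewrite !in_itv/= => /andP[? ?] /andP[? ?] /andP[? ?].
by apply/andP; split; lra.
Qed.

(** Squaring z makes the sign of this derivative that of 2h + k wherever z is nonzero, whatever the
    sign of z. *)
Let dg (k x : R) : x \in `]a, b[ ->
  is_derive x 1 (fun t => z t ^+ 2 * expR (k * t))
    ((2 * h x + k) * z x ^+ 2 * expR (k * x)).
Proof.
move=> xab; have dl := is_derive_mull k x.
have de := @is_derive1_comp _ expR (fun t => k * t) x _ _ (is_derive_expR _) dl.
have dz2 := is_deriveX 2 (dz xab).
apply: is_derive_eq (is_deriveM dz2 de) _; rewrite /GRing.scale/=.
have -> : (z ^+ 2) x = z x ^+ 2 by rewrite !expr2.
by ring.
Qed.

(* Gronwall: z^2 exp(kt) is monotone for k of either sign and |k| large. *)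
Lemma linear_ode_eq0 (x0 : R) : x0 \in `]a, b[ -> z x0 = 0 ->
  {in `]a, b[, forall x : R, z x = 0}.
Proof.
move=> x0ab z0 x xab.
(* The coefficient h may be unbounded near a and b; it is bounded on each compact segment inside. *)
have bnd (s t : R) : s \in `]a, b[ -> t \in `]a, b[ -> s <= t ->
    exists M, {in `[s, t], forall r, `|h r| <= M}.
  move=> sab tab st; have [|r _ H] := @EVT_max _ (fun r => `|h r|) s t st.
    apply: continuous_in_subspaceT => r /set_mem rst.
    apply: (@continuous_comp _ _ _ h (fun r => `|r|)); last exact: norm_continuous.
    by apply: ch; exact: (sub sab tab rst).
  by exists `|h r| => w wst; exact: H.
have mvt (k s t : R) : s \in `]a, b[ -> t \in `]a, b[ -> s <= t ->
    exists2 r, r \in `[s, t] &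
      z t ^+ 2 * expR (k * t) - z s ^+ 2 * expR (k * s) =
      (2 * h r + k) * z r ^+ 2 * expR (k * r) * (t - s).
  move=> sab tab st; apply: (@MVT_segment _ (fun r => z r ^+ 2 * expR (k * r))
    (fun r => (2 * h r + k) * z r ^+ 2 * expR (k * r)) s t st).
    by move=> r /subset_itv_oo_cc rst; exact: (dg k (sub sab tab rst)).
  apply: derivable_within_continuous => r rst.
  by have [] := dg k (sub sab tab rst).
suff : z x ^+ 2 <= 0.
  by move=> h0; apply/eqP; rewrite -(sqrf_eq0 (z x)) eq_le h0 sqr_ge0.
have [x0x|/ltW xx0] := leP x0 x.
  (* To the right of x0 take k = - 2M, so that 2h + k <= 0 and the weighted square cannot rise from
     0; to the left, k = 2M works symmetrically. *)
  have [M HM] := bnd _ _ x0ab xab x0x.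
  have [r rx E] := mvt (- (2 * M)) _ _ x0ab xab x0x.
  have e0 := expR_gt0 (- (2 * M) * x).
  rewrite -(pmulr_lle0 _ e0).
  move: E; rewrite z0 expr0n mul0r subr0 => ->.
  apply: mulr_le0_ge0; last by rewrite subr_ge0.
  apply: mulr_le0_ge0; last exact: expR_ge0.
  apply: mulr_le0_ge0; last exact: sqr_ge0.
  by have := HM r rx; rewrite ler_norml; lra.
have [M HM] := bnd _ _ xab x0ab xx0.
have [r rx E] := mvt (2 * M) _ _ xab x0ab xx0.
have e0 := expR_gt0 (2 * M * x).
rewrite -(pmulr_lle0 _ e0) -oppr_ge0.
move: E; rewrite z0 expr0n mul0r sub0r => ->.
apply: mulr_ge0; last by rewrite subr_ge0.
apply: mulr_ge0; last exact: expR_ge0.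
apply: mulr_ge0; last exact: sqr_ge0.
by have := HM r rx; rewrite ler_norml; lra.
Qed.

(** A nonpositive value would give a zero by the intermediate value theorem, and a single zero
    forces z to vanish at x0 as well. *)
Lemma linear_ode_gt0 (x0 : R) : x0 \in `]a, b[ -> 0 < z x0 ->
  {in `]a, b[, forall x : R, 0 < z x}.
Proof.
move=> x0ab z0 x xab; rewrite ltNge; apply/negP => zx.
have ivt (s t : R) : s \in `]a, b[ -> t \in `]a, b[ -> s <= t ->
    Num.min (z s) (z t) <= 0 <= Num.max (z s) (z t) -> False.
  move=> sab tab st st0; have [|r rst zr] := @IVT _ z s t 0 st _ st0.
    apply: derivable_within_continuous => r rst.
    by have [] := dz (sub sab tab rst).
  have := @linear_ode_eq0 r (sub sab tab rst) zr x0 x0ab.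
  by move: z0 => /[swap] ->; rewrite ltxx.
have zz : z x <= z x0 by rewrite (le_trans zx)// ltW.
have [x0x|/ltW xx0] := leP x0 x.
  by apply: (ivt x0 x) => //; rewrite (min_idPr zz) (max_idPl zz) zx ltW.
by apply: (ivt x x0) => //; rewrite (min_idPl zz) (max_idPr zz) zx ltW.
Qed.

End LinearODE.

(** * From a positive solution to the formula *)

Section Uniqueness.
Variables (R : realType) (p q H : R).
Hypotheses (hp : 1 < p) (hq : 1 < q) (hH : 0 < H).
Variable u : R -> R.
Hypothesis su : positive_solution p q H u.

Local Notation P := (conj_exp p).
Local Notation T := (gpi P q / 2).
Local Notation S := (gsin P q).
Local Notation v := (derive1 u).

Let p0 : 0 < p. Proof. exact: lt_trans hp. Qed.
Let q0 : 0 < q. Proof. exact: lt_trans hq. Qed.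
Let hP : 1 < P. Proof. exact: conj_exp_gt1. Qed.
Let pN : p != 0. Proof. by rewrite gt_eqF. Qed.
Let qN : q != 0. Proof. by rewrite gt_eqF. Qed.
Let pq0 : 0 < p + q. Proof. exact: addr_gt0. Qed.
Let pqN : p + q != 0. Proof. by rewrite gt_eqF. Qed.

Let h0H : H / 2 \in `]0, H[.
Proof. by rewrite in_itv/= divr_gt0//= ltr_pdivrMr// ltr_pMr// ltr1n. Qed.

Let u_gt0 : {in `]0, H[, forall x : R, 0 < u x}.
Proof. by case: su. Qed.

Let du : {in `]0, H[, forall x : R, is_derive x 1 u (v x)}.
Proof.
by case: su => _ d _ _ _ x /d[du _]; split => //; rewrite derive1E.
Qed.

(** Since u > 0, the equation can be solved for u''; its remaining terms factor. *)
Let dv : {in `]0, H[, forall x : R,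
  is_derive x 1 v ((p * v x + 1) * (q * v x - 1) / ((p + q) * u x))}.
Proof.
case: su => _ d _ _ ode x x0H; have [_ dvx] := d x x0H.
split=> //; rewrite -derive1E; have := ode x x0H.
rewrite /derive1n/= => E; have uN : u x != 0 by rewrite gt_eqF// u_gt0.
apply: (@mulIf _ ((p + q) * u x)); first by rewrite mulf_neq0.
rewrite divfK ?mulf_neq0//; apply/eqP; rewrite -subr_eq0 -E.
by apply/eqP; ring.
Qed.

Let coeff_continuous (m n : R) :
  {in `]0, H[, continuous (fun x => (m * v x + n) / ((p + q) * u x))}.
Proof.
move=> x x0H.
have cu := is_derive_continuous (du x0H).
have cv := is_derive_continuous (dv x0H).
apply: cvgM.
  by apply: cvgD; [apply: cvgM => //|]; exact: cvg_cst.
apply: cvgV; first by rewrite mulf_neq0// gt_eqF// u_gt0.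
by apply: cvgM => //; exact: cvg_cst.
Qed.

Lemma positive_solution_slope :
  {in `]0, H[, forall x : R, 0 < 1 - q * v x /\ 0 < p * v x + 1}.
Proof.
have [cu _ [u0 uH] _ _] := su.
(* At the point given by Rolle's theorem both 1 - q v and p v + 1 equal 1. *)
have [||x0 x00H [_ dx0]] := @Rolle _ u 0 H hH _ cu; [|by rewrite u0 uH|].
  by move=> x x0H; have [] := du x0H.
have v0 : v x0 = 0 by rewrite derive1E.
move=> x x0H; split.
  pose h x := q * ((p * v x + 1) / ((p + q) * u x)).
  apply: (@linear_ode_gt0 _ 0 H (fun x => 1 - q * v x) h _ _ x0) => //.
  - move=> t t0H; apply: is_derive_eq (is_derive_cstB 1 (is_deriveZ q (dv t0H))) _.
    by rewrite /h /GRing.scale/=; ring.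
  - move=> t t0H; apply: cvgM; first exact: cvg_cst.
    exact: coeff_continuous.
  - by rewrite v0 mulr0 subr0.
pose h x := p * ((q * v x - 1) / ((p + q) * u x)).
apply: (@linear_ode_gt0 _ 0 H (fun x => p * v x + 1) h _ _ x0) => //.
- move=> t t0H.
  have d := is_deriveD (is_deriveZ p (dv t0H)) (is_derive_cst (1 : R) t 1).
  apply: (is_derive_eq (d : is_derive t 1 (fun x => p * v x + 1) _)).
  by rewrite /h /GRing.scale/=; ring.
- move=> t t0H; apply: cvgM; first exact: cvg_cst.
  exact: coeff_continuous.
- by rewrite v0 mulr0 add0r.
Qed.

(** For the expected solution W(cx) / (qc) this expression is exactly S(cx)^q, as the formula for W'
    shows. *)
Let y (x : R) := p * (1 - q * v x) / (p + q).

Let y_itv : {in `]0, H[, forall x : R, 0 < y x < 1}.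
Proof.
move=> x /positive_solution_slope[h1 h2].
rewrite /y divr_gt0 ?mulr_gt0//= ltr_pdivrMr// mul1r.
rewrite -subr_gt0.
have -> : p + q - p * (1 - q * v x) = q * (p * v x + 1) by ring.
by rewrite mulr_gt0.
Qed.

(** In terms of y the equation becomes logistic, with rate 1 / u. *)
Let dy : {in `]0, H[, forall x : R, is_derive x 1 y (y x * (1 - y x) / u x)}.
Proof.
move=> x x0H; have uN : u x != 0 by rewrite gt_eqF// u_gt0.
have d := is_deriveZ (p / (p + q))
  (is_derive_cstB 1 (is_deriveZ q (dv x0H))).
have yE : y = (p / (p + q)) \*: (fun x => 1 - (q \*: v) x).
  by apply/funext => t; rewrite /y /= /GRing.scale/= mulrAC.
rewrite [X in is_derive _ _ X]yE.
apply: is_derive_eq d _; rewrite /y /GRing.scale/=.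
by field; rewrite uN pqN.
Qed.

(* The first integral of the equation: u^-1 y^(1/q) (1 - y)^(1/p) is constant,
   where u' = 1/q - (1/p + 1/q) y. *)
Let first_integral : exists2 k : R, 0 < k &
  {in `]0, H[, forall x : R, u x = k * y x `^ q^-1 * (1 - y x) `^ p^-1}.
Proof.
(* Logarithms turn the product into a sum; L' is (v - (1 - y)/q + y/p) / u, which vanishes by the
   definition of y. *)
pose L x := ln (u x) - (q^-1 * ln (y x) + p^-1 * ln (1 - y x)).
have dL : {in `]0, H[, forall x : R, is_derive x 1 L 0}.
  move=> x x0H; have u0 := u_gt0 x0H; have /andP[y0 y1] := y_itv x0H.
  have y10 : 0 < 1 - y x by rewrite subr_gt0.
  have d1 := @is_derive1_comp _ (@ln R) u x _ _ (is_derive1_ln u0) (du x0H).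
  have d2 := @is_derive1_comp _ (@ln R) y x _ _ (is_derive1_ln y0) (dy x0H).
  have d3 := @is_derive1_comp _ (@ln R) (fun x => 1 - y x) x _ _
    (is_derive1_ln y10) (is_derive_cstB 1 (dy x0H)).
  have d := is_deriveB d1 (is_deriveD (is_deriveZ q^-1 d2) (is_deriveZ p^-1 d3)).
  apply: is_derive_eq d _; rewrite /GRing.scale/=.
  have -> : v x = q^-1 - (p^-1 + q^-1) * y x.
    by rewrite /y; field; rewrite pqN pN qN.
  by field; rewrite pN qN !gt_eqF.
exists (expR (L (H / 2))); first exact: expR_gt0.
move=> x x0H; have u0 := u_gt0 x0H; have /andP[y0 y1] := y_itv x0H.
have y10 : 0 < 1 - y x by rewrite subr_gt0.
rewrite -(derive0_oo_cst dL x0H h0H) /powR !gt_eqF// -!expRD /L -addrA subrK.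
by rewrite lnK// posrE.
Qed.

Lemma positive_solution_formula (x : R) : 0 <= x <= H ->
  u x = (q * (gpi P q / (2 * H)))^-1 * profile p q (gpi P q / (2 * H) * x).
Proof.
have [k k0 uE] := first_integral.
have kN : k != 0 by rewrite gt_eqF.
pose c := (q * k)^-1.
have c0 : 0 < c by rewrite invr_gt0 mulr_gt0.
(* The candidate for S(cx + D). *)
pose s x := y x `^ q^-1.
have qV0 : 0 < q^-1 by rewrite invr_gt0.
have s01 : {in `]0, H[, forall x : R, 0 < s x < 1}.
  move=> t /y_itv/andP[y0 y1]; rewrite powR_gt0//=.
  have : y t `^ q^-1 < 1 `^ q^-1 by rewrite gt0_ltr_powR ?nnegrE// ltW.
  by rewrite powR1.
have sq : {in `]0, H[, forall x : R, s x `^ q = y x}.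
  move=> t /y_itv/andP[y0 y1].
  by rewrite /s -powRrM mulVf// powRr1// ltW.
(* Substituting u = k y^(1/q) (1 - y)^(1/p) into y' cancels every power of y and 1 - y, leaving the
   constant 1 / (qk). *)
have dG : {in `]0, H[, forall x : R,
    is_derive x 1 (fun x => gasin P q (s x) - c * x) 0}.
  move=> t t0H; have /andP[y0 y1] := y_itv t0H.
  have y10 : 0 < 1 - y t by rewrite subr_gt0.
  have ds := @is_derive_powR_comp _ y q^-1 t _ y0 (dy t0H).
  have dg := @is_derive1_comp _ _ s t _ _ (is_derive_gasin hP hq (s01 _ t0H)) ds.
  have d := is_deriveB dg (is_deriveZ c (is_derive_id t 1)).
  apply: is_derive_eq d _; rewrite /GRing.scale/= mulr1.
  rewrite sq// uE// /c; set A := _ `^ P^-1.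
  have A0 : A != 0 by rewrite gt_eqF// powR_gt0.
  have B0 : (1 - y t) `^ p^-1 != 0 by rewrite gt_eqF// powR_gt0.
  have C0 : y t `^ (q^-1 - 1) != 0 by rewrite gt_eqF// powR_gt0.
  have E1 : A * (1 - y t) `^ p^-1 = 1 - y t.
    rewrite /A -powRD; last by rewrite (gt_eqF y10) implybT.
    by rewrite (conj_expV hp) subrK powRr1// ltW.
  have E2 : y t * y t `^ (q^-1 - 1) = y t `^ q^-1 by rewrite mulr_powRB1// ltW.
  rewrite -E2 -[X in _ * (y t * X / _)]E1.
  by field; rewrite A0 B0 C0 kN qN gt_eqF.
pose D := gasin P q (s (H / 2)) - c * (H / 2).
have GE : {in `]0, H[, forall x : R, gasin P q (s x) = c * x + D}.
  move=> t t0H; rewrite /D -(derive0_oo_cst dG t0H h0H).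
  by rewrite addrC subrK.
have cD_oo : {in `]0, H[, forall x : R, 0 < c * x + D < T}.
  move=> t t0H; rewrite -GE// gpi_half -(gasin0 P q).
  by have /andP[s0 s1] := s01 _ t0H; rewrite !gasin_lt// ltW.
have ccD : {within `[0, H], continuous (fun x => c * x + D)}.
  apply: derivable_within_continuous => t _.
  by apply: derivableD => //; exact: derivableZ.
(* The bounds pass to the closed interval by continuity, so that the profile can be used at 0 and
   H. *)
have cD_cc : {in `[0, H], forall x : R, 0 <= c * x + D <= T}.
  move=> t t0H; apply/andP; split.
    apply: (within_continuous_ge0 hH ccD _ t0H) => r r0H /=.
    by have /andP[/ltW] := cD_oo r r0H.
  rewrite -subr_ge0.
  have cTD : {within `[0, H], continuous (cst T - (fun x => c * x + D))}.
    by apply: within_continuousB => //; exact: within_continuous_cst.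
  apply: (within_continuous_ge0 hH cTD _ t0H) => r r0H.
  by rewrite !fctE subr_ge0; have /andP[_ /ltW] := cD_oo r r0H.
have uP : {in `[0, H], forall x : R, u x = k * profile p q (c * x + D)}.
  apply: (@within_continuous_eq _ u (fun x => k * profile p q (c * x + D)) _ _ hH).
  - by case: su.
  - have cP : {within `[0, H], continuous (profile p q \o (fun x => c * x + D))}.
      apply: (within_continuous_compose _ ccD (profile_continuous hp hq)).
      by move=> t t0H; exact: cD_cc.
    exact: (within_continuousM (@within_continuous_cst _ _ k) cP).
  - move=> t t0H; have s_cc : s t \in `[0, 1].
      by rewrite in_itv/=; have /andP[/ltW -> /ltW ->] := s01 _ t0H.
    rewrite uE// -GE// /profile (gasinK hP hq)// sq//.
    by rewrite -mulrA; congr (_ * _); rewrite mulrC.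
have [_ _ [u0 uH] _ _] := su.
have T0 := gpi_half_gt0 hP hq.
have cH0 : 0 < c * H by rewrite mulr_gt0.
have in0 : 0 \in `[0, H] by rewrite in_itv/= lexx ltW.
have inH : H \in `[0, H] by rewrite in_itv/= lexx ltW.
(* From u(0) = 0, D is 0 or T; D = T would push cH + D beyond T. *)
have D0 : D = 0.
  have := uP 0 in0; rewrite u0 mulr0 add0r => /esym/eqP.
  rewrite mulf_eq0 (negbTE kN)/= => /eqP.
  have := cD_cc 0 in0; rewrite mulr0 add0r => D_cc.
  move=> /(profile_eq0 hp hq D_cc)[//|DT].
  by have /andP[_] := cD_cc H inH; lra.
(* From u(H) = 0, cH is 0 or T, and cH > 0. *)
have cHT : c * H = T.
  have := uP H inH; rewrite uH D0 addr0 => /esym/eqP.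
  rewrite mulf_eq0 (negbTE kN)/= => /eqP.
  have := cD_cc H inH; rewrite D0 addr0 => D_cc.
  by move=> /(profile_eq0 hp hq D_cc)[|//]; lra.
have -> : gpi P q / (2 * H) = c.
  by rewrite invfM mulrA -cHT mulfK// gt_eqF.
move=> x0H; rewrite uP ?in_itv// D0 addr0; congr (_ * _).
by rewrite /c invfM; field; rewrite kN qN.
Qed.

End Uniqueness.

Theorem theorem2p1 (R : realType) (H p q : R)
    (hH : 0 < H) (hp : 1 < p) (hq : 1 < q) (u : R -> R) :
  positive_solution p q H u <->
  (forall x : R, 0 <= x <= H ->
    u x = 2 * H / (q * gpi (conj_exp p) q)
          * gcos (conj_exp p) q (gpi (conj_exp p) q / (2 * H) * x)
              `^ (conj_exp p - 1)
          * gsin (conj_exp p) q (gpi (conj_exp p) q / (2 * H) * x)).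
Proof.
split=> [su x x0H|uE].
  rewrite (formula_profileE hp hq hH x0H).
  exact: positive_solution_formula.
apply: (profile_solution hp hq hH) => x x0H.
by rewrite uE// (formula_profileE hp hq hH x0H).
Qed.
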